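(* Let $k\in\mathbb N$, $m\in\mathbb Z$, $n\in\mathbb N$, let $p(n)$ be the number of integer partitions of $n$ with $p(0)=1$ and $p(-\ell)=0$ for $\ell\in\mathbb N$, and put \[ F_k(1;|m|,n)=p(n-(|m|+k)+1)-p(n-(|m|+k)). \] (i) If $|m|>(n+3)/2-2k$, then $N_k(m,n)=F_k(1;|m|,n)$. (ii) For any fixed $c>0$, uniformly for $c\sqrt n\le |m|<n/2$, as $n\to\infty$, \[ N_k(m,n)=F_k(1;|m|,n)\left(1+O_k\!\left(e^{-\frac{\pi|m|}{\sqrt{6n}}}+e^{-\frac{\pi\sqrt{n/6}}{5}}\right)\right). \]
   Context: For $k\in\mathbb N$ and $m\in\mathbb Z$, Garvan's $k$-rank counts $N_k(m,n)$ are defined by \[ \sum_{n\ge0}N_k(m,n)q^n=\Big(\prod_{r\ge1}(1-q^r)^{-1}\Big)\sum_{n\ge1}(-1)^{n-1}q^{n((2k-1)n-1)/2+|m|n}(1-q^n). \] The implied constant in (ii) may depend on $k$ and $c$. *)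

(* Defs.v *)
From mathcomp Require Import all_boot all_order all_algebra.
From mathcomp Require Import zify.

Set Implicit Arguments.
Unset Strict Implicit.
Unset Printing Implicit Defensive.

Import Order.TTheory GRing.Theory Num.Theory.
Local Open Scope ring_scope.

Definition is_partition (n : nat) (s : seq nat) : bool :=
  [&& sorted geq s, all (leq 1) s & sumn s == n].

(* A partition of n has at most n parts, each of them at most n; the sum is
   over the number l of parts. *)
Definition npart (n : nat) : nat :=
  (\sum_(l < n.+1)
     #|[set t : l.-tuple 'I_n.+1 | is_partition n [seq val i | i <- t]]|)%N.

Definition npartz (z : int) : nat :=
  if z is Posz n then npart n else 0%N.

(* F_k(1; a, n), with a standing for |m|. *)
Definition F1 (k a n : nat) : int :=
  (npartz (n%:Z - (a%:Z + k%:Z) + 1))%:Z - (npartz (n%:Z - (a%:Z + k%:Z)))%:Z.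

(* For k, l >= 1 the subtractions do not truncate and l((2k-1)l-1) is even, so
   the halving is exact. *)
Definition rank_exp (k a l : nat) : nat :=
  ((l * ((2 * k - 1) * l - 1))./2 + a * l)%N.

Definition geom (B r : nat) : {poly int} := \sum_(0 <= j < B.+1) 'X^(r * j).

(* The generating function of the k-rank counts as a formal power series over
   the integers, modulo X^(B+1): every factor, term or power left out has no
   effect on the coefficients of degree at most B.  See geomP and
   rank_gfun_stable. *)
Definition rank_gfun (k a B : nat) : {poly int} :=
  (\prod_(1 <= r < B.+1) geom B r) *
  \sum_(1 <= l < B.+2) (-1) ^+ l.-1 *: ('X^(rank_exp k a l) * (1 - 'X^l)).

Definition garvan_rank (k : nat) (m : int) (n : nat) : int :=
  (rank_gfun k `|m|%N n)`_n.

Lemma geomP (B r : nat) : (1 - 'X^r) * geom B r = 1 - 'X^(r * B.+1).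
Proof.
rewrite /geom big_mkord exprM -[in RHS](expr1n _ B.+1) subrXX; congr (_ * _).
by apply: eq_bigr => i _; rewrite expr1n mul1r exprM.
Qed.

Definition eq_upto (n : nat) (p q : {poly int}) : Prop :=
  forall i, (i <= n)%N -> p`_i = q`_i.

Lemma eq_uptoM n p p' q q' :
  eq_upto n p p' -> eq_upto n q q' -> eq_upto n (p * q) (p' * q').
Proof.
move=> hp hq i hi; rewrite !coefM; apply: eq_bigr => j _.
by rewrite hp ?hq //; have := ltn_ord j; lia.
Qed.

Lemma rank_exp_ge k a l : (0 < k)%N -> (0 < l)%N -> (l.-1 <= rank_exp k a l)%N.
Proof.
move=> hk hl; rewrite /rank_exp.
suff : (2 * l.-1 <= l * ((2 * k - 1) * l - 1))%N by lia.
by nia.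
Qed.

Lemma geomS B r : (0 < r)%N -> eq_upto B (geom B.+1 r) (geom B r).
Proof.
move=> hr i hi; rewrite /geom big_nat_recr //= coefD coefXn.
have /negbTE-> : i != (r * B.+1)%N by nia.
by rewrite addr0.
Qed.

Lemma geom1 B r : (B < r)%N -> eq_upto B (geom B r) 1.
Proof.
move=> hr i hi; rewrite /geom big_nat_recl //= muln0 expr0 coefD.
rewrite coef_sum big1 ?addr0 // => j _; rewrite coefXn.
by have /negbTE-> : i != (r * j.+1)%N by nia.
Qed.

Lemma rank_gfunS k a B :
  (0 < k)%N -> eq_upto B (rank_gfun k a B.+1) (rank_gfun k a B).
Proof.
move=> hk; rewrite /rank_gfun; apply: eq_uptoM.
  rewrite big_nat_recr //= -[X in eq_upto _ _ X]mulr1.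
  apply: eq_uptoM; last first.
    by move=> i hi; rewrite geomS // (@geom1 B B.+1).
  rewrite !big_nat; elim/big_ind2: _ => // [p p' q q'|r /andP[hr _]].
    exact: eq_uptoM.
  exact: geomS.
move=> i hi; rewrite big_nat_recr //= coefD coefZ coefXnM.
suff -> : (i < rank_exp k a B.+2)%N by rewrite mulr0 addr0.
by have := @rank_exp_ge k a B.+2 hk isT; lia.
Qed.

Lemma rank_gfun_stable k (m : int) n B : (0 < k)%N -> (n <= B)%N ->
  (rank_gfun k `|m|%N B)`_n = garvan_rank k m n.
Proof.
move=> hk; elim: B => [|B IH]; first by rewrite leqn0 => /eqP->.
rewrite leq_eqVlt => /predU1P[->//|hn].
by rewrite rank_gfunS // IH.
Qed.

(* Main.v *)
Require Import Defs.
From mathcomp Require Import all_boot all_order all_algebra.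
From mathcomp Require Import reals sequences exp trigo.
From mathcomp Require Import interval_inference topology normedtype derive.
From mathcomp Require Import zify ring lra.

Import Order.TTheory GRing.Theory Num.Theory.
Import numFieldNormedType.Exports.
Local Open Scope ring_scope.

(** Let f(j) = p(j) - p(j-1), the number of partitions of j without part 1, and
    let e_l be the exponent of q in the l-th term of the rank generating
    function.  Then N_k(m,n) is the sum over l >= 1 of
    (-1)^(l-1) (f(n-e_l) + ... + f(n-e_l-l+1)); the term l = 1 is F_k(1;|m|,n) =
    f(M) with M = n-|m|-k+1, and e_l > n for l >= 2 in case (i).

    In case (ii) the terms l >= 2 are controlled, without the circle method, by
    f(i) <= C exp(-s(m-i)) f(m) for i <= m <= n and s = pi/sqrt(6n) - 4/n.  The
    logarithmic derivative of the generating function gives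
    m f(m) = sum_(d >= 2, e >= 1) d f(m-de), so g(j) = f(j) exp(-sj) satisfies a
    renewal equation whose weights d exp(-sde)/m have total mass at least 1 for
    m <= n: this is where pi^2/6 = sum 1/e^2 enters.  Hence g(m) is bounded below
    by a constant times the least value of g on a window [i, i+O(1/s)], provided
    the mass that jumps below i is dominated by the mass that lands in the window;
    on the window itself, f is nondecreasing. *)

(** * Partitions and products of geometric series *)

(** Each factor truncates [1 / (1 - 'X^i)], so up to degree [B] this is the generating function of
    the partitions with all parts between [a] and [r]. *)
Definition partprod (a B r : nat) : {poly int} := \prod_(a <= i < r.+1) geom B i.

(** Multiplying by [1 - 'X^r.+1] collapses the last factor to [1 - 'X^(r.+1 * B.+1)], which is 1 up
    to degree [B]. Combinatorially, a partition either avoids the part [r.+1] or loses one copy of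
    it. *)
Lemma coef_partprodS (a B r n : nat) : (a <= r.+1)%N -> (n <= B)%N ->
  (partprod a B r.+1)`_n =
  (partprod a B r)`_n +
  (if (r < n)%N then (partprod a B r.+1)`_(n - r.+1) else 0).
Proof.
move=> har hnB; have defP : partprod a B r.+1 = partprod a B r * geom B r.+1.
  by rewrite /partprod big_nat_recr.
have := congr1 (fun p : {poly int} => (partprod a B r * p)`_n) (geomP B r.+1).
rewrite mulrCA -defP mulrBl mul1r mulrBr mulr1 !coefB coefXnM coefMXn.
have -> : (n < r.+1 * B.+1)%N by nia.
by rewrite subr0 ltnNge; case: (r < n)%N => /= /eqP; rewrite ?subr0 ?subr_eq => /eqP ->;
  rewrite ?addr0.
Qed.

Lemma partprod_nil (a B r n : nat) : (r < a)%N -> (partprod a B r)`_n = (n == 0%N)%:R.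
Proof. by move=> h; rewrite /partprod big_geq // coef1. Qed.

(* The partitions of [n] into parts at most [r]; the fuel [f] must exceed [r + n]. *)
Fixpoint parts (f r n : nat) : seq (seq nat) :=
  if f is f'.+1 then
    if n == 0%N then [:: [::]] else
    if r is r'.+1 then
      parts f' r' n ++
      (if (r' < n)%N then [seq r :: s | s <- parts f' r (n - r)] else [::])
    else [::]
  else [::].

Lemma mem_parts (f r n : nat) (s : seq nat) : (r + n < f)%N ->
  (s \in parts f r n) = [&& path geq r s, all (leq 1) s & sumn s == n].
Proof.
elim: f r n s => [|f IH] r n s; rewrite ?ltn0 //= => hf.
case: eqP => [->|/eqP n0].
  rewrite inE; case: s => [|x s] //=.
  by case: x => [|x] /=; rewrite ?andbF // ?eqE.
case: r hf => [|r] hf.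
  case: s => [|x s] /=; first by rewrite eq_sym (negbTE n0).
  by case: x => [|x]; rewrite in_nil /= ?andbF.
rewrite mem_cat IH; last lia.
(* The second half of the list consists of the partitions with largest part exactly [r.+1]. *)
have -> : s \in (if (r < n)%N
    then [seq r.+1 :: s | s <- parts f r.+1 (n - r.+1)] else [::])
   = [&& (r < n)%N, head 0%N s == r.+1, path geq r.+1 s, all (leq 1) s & sumn s == n].
  case: ltnP => // hrn /=.
  apply/mapP/idP => [[t ht ->]|].
    rewrite IH in ht; last lia.
    by case/and3P: ht => h1 h2 h3; rewrite /= eqxx leqnn h1 h2 /=; lia.
  case: s => [|x s] //= /and4P[/eqP-> /andP[_ h1] h2 h3].
  exists s => //; rewrite IH; last lia.
  by rewrite h1 -[all _ _]/((0 < r.+1)%N && all (leq 1) s) h2 /=; lia.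
case: s => [|x s] /=; first by rewrite eq_sym (negbTE n0) andbF.
rewrite (leq_eqVlt x r.+1) !ltnS.
case: (ltngtP x r.+1) => //= hx.
- by rewrite -ltnS hx andbF /= orbF.
- by rewrite leqNgt (ltnW hx) andbF.
- subst x; rewrite ltnn /=.
  by case: ltnP => hr /=; rewrite ?andbT //; apply/esym/negbTE/negP; lia.
Qed.

Lemma uniq_parts f r n : (r + n < f)%N -> uniq (parts f r n).
Proof.
elim: f r n => [|f IH] r n //= hf; case: eqP => // /eqP n0; case: r hf => [|r] hf //.
rewrite cat_uniq IH; last lia.
case: ifP => hrn /=; last by [].
rewrite map_inj_uniq ?IH ?andbT; [|lia|by move=> u v []].
apply/hasPn => s /mapP[t _ ->]; rewrite mem_parts; last lia.
by rewrite /= ltnn.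
Qed.

(** The recursion of [parts] is the recurrence of [coef_partprodS]. *)
Lemma size_parts f r n B : (r + n < f)%N -> (n <= B)%N ->
  (size (parts f r n))%:Z = (partprod 1 B r)`_n.
Proof.
elim: f r n => [|f IH] r n //= hf hB; case: eqP => [->|/eqP n0].
  elim: {hf}r => [|r IHr]; first by rewrite partprod_nil.
  by rewrite coef_partprodS // -IHr ltn0 addr0.
case: r hf => [|r] hf; first by rewrite partprod_nil // (negbTE n0).
rewrite coef_partprodS // size_cat PoszD [X in X + _ = _]IH //.
case: ifP => hrn; last by rewrite addr0.
by rewrite size_map IH //; lia.
Qed.

Lemma npartE n B : (n <= B)%N -> (npart n)%:Z = (partprod 1 B n)`_n.
Proof.
move=> hB; rewrite -(size_parts (n + n).+1) //.
congr Posz.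
pose A (l : nat) :=
  [set t : l.-tuple 'I_n.+1 | is_partition n [seq val i | i <- t]].
pose S := [seq [seq val i | i <- tval t] | l <- iota 0 n.+1, t <- enum (A l)].
have -> : npart n = size S.
  rewrite size_allpairs_dep /npart sumnE big_map -[iota 0 n.+1]/(index_iota 0 n.+1).
  rewrite big_mkord.
  by apply: eq_bigr => l _; rewrite cardE.
apply: perm_size; apply: uniq_perm; last first.
- move=> s; rewrite mem_parts; last lia.
  have -> : [&& path geq n s, all (leq 1) s & sumn s == n] = is_partition n s.
    rewrite /is_partition; case: s => [|x s] //=.
    case: (sumn s) => [|m]; case: (leqP x n) => //= hx; rewrite ?andbF //.
    - by apply/esym; apply/negP => /and3P[_ _]; lia.
    - by apply/esym; apply/negP => /and3P[_ _]; lia.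
  apply/allpairsPdep/idP => [[l [t [_]]]|hs].
    by rewrite mem_enum inE => ht ->.
  have [_ h1 /eqP h2] := and3P hs.
  have hsz : (size s <= n)%N.
    rewrite -h2; elim: (s) h1 => //= x u IHu /andP[hx /IHu]; lia.
  (* No part exceeds the sum [n], so [inord] below loses nothing. *)
  have hle : all (fun x => x < n.+1)%N s.
    have : all (fun x => x <= sumn s)%N s.
      elim: (s) => //= x u IHu; rewrite leq_addr /=.
      by apply: sub_all IHu => y; lia.
    by rewrite h2.
  pose t := [seq (inord x : 'I_n.+1) | x <- s].
  have ht : [seq val i | i <- t] = s.
    rewrite -map_comp -[RHS]map_id; apply/eq_in_map => x hx /=.
    by rewrite inordK //; exact: (allP hle).
  have hsize : size t == size s by rewrite size_map.
  exists (size s), (Tuple hsize); split; rewrite ?ht //.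
    by rewrite mem_iota; lia.
  by rewrite mem_enum inE /= ht.
- by apply: uniq_parts; lia.
- apply: allpairs_uniq_dep; first exact: iota_uniq.
    by move=> l _; exact: enum_uniq.
  move=> [l t] [l' t'] _ _ /= /(inj_map val_inj) htt.
  have hl : l = l' by rewrite -(size_tuple t) htt size_tuple.
  by subst l'; congr existT; apply: val_inj.
Qed.

Lemma coef_partprod_stable a B r n : (n <= B)%N -> (n <= r)%N -> (a <= n.+1)%N ->
  (partprod a B r)`_n = (partprod a B n)`_n.
Proof.
move=> hB hr ha; elim: r hr => [|r IH] hr; first by move: hr; rewrite leqn0 => /eqP->.
move: hr; rewrite leq_eqVlt => /predU1P[->//|hr].
by rewrite coef_partprodS ?IH //; [rewrite ltnNge -ltnS hr addr0|lia].
Qed.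

(* Counts the partitions of [n] without part 1, by [coef_partprod2]. *)
Definition dpart (n : nat) : int :=
  (npart n)%:Z - (if n is n'.+1 then npart n' else 0%N)%:Z.

Lemma coef_1subX_partprod B r n : (n <= B)%N -> (n <= r)%N ->
  ((1 - 'X) * partprod 1 B r)`_n = dpart n.
Proof.
move=> hB hr; rewrite mulrBl mul1r coefB coefXM /dpart.
rewrite coef_partprod_stable // -npartE //; case: n hB hr => [|n] hB hr //=.
by rewrite coef_partprod_stable -?npartE //; lia.
Qed.

(** Up to degree [B], the factor [1 - 'X] cancels [geom B 1], the factor of the part 1. *)
Lemma coef_partprod2 B r n : (n <= B)%N -> (n <= r)%N -> (0 < r)%N ->
  (partprod 2 B r)`_n = dpart n.
Proof.
move=> hB hr r0; rewrite -(coef_1subX_partprod B r) //.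
rewrite /partprod (@big_ltn _ _ _ 1) // mulrA -['X in RHS]expr1 geomP mul1n.
by rewrite mulrBl mul1r coefB coefXnM ltnS hB subr0.
Qed.

Lemma coef_partprod_ge0 a B r n : (0 < a)%N -> (n <= B)%N -> 0 <= (partprod a B r)`_n.
Proof.
move=> a0; elim/ltn_ind: n r => n IHn; elim=> [|r IHr] hB.
  by rewrite partprod_nil // ler0n.
have [har|har] := leqP a r.+1; last by rewrite partprod_nil // ler0n.
rewrite coef_partprodS //; apply: addr_ge0; first exact: IHr.
by case: ifP => // hr; apply: IHn; lia.
Qed.

Lemma coef_partprod_le a B r n : (0 < a)%N -> (n <= B)%N ->
  (partprod a B r)`_n <= (partprod a B r.+1)`_n.
Proof.
move=> a0 hB; have [har|har] := leqP a r.+1; last by rewrite !partprod_nil //; lia.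
rewrite [leRHS]coef_partprodS // lerDl.
by case: ifP => // hr; apply: coef_partprod_ge0; lia.
Qed.

(* Enlarging the largest part by one is injective. *)
Lemma coef_partprod_shift B r n : (0 < n < B)%N -> (0 < r)%N ->
  (partprod 2 B r)`_n <= (partprod 2 B r.+1)`_n.+1.
Proof.
move=> /andP[n0 hB]; elim: r => // r IH _.
case: r IH => [_|r IH].
  by rewrite partprod_nil // (negbTE (lt0n_neq0 n0)); apply: coef_partprod_ge0.
rewrite [leRHS]coef_partprodS // [leLHS]coef_partprodS ?(ltnW hB) //.
apply: lerD; first exact: IH.
rewrite ltnS; case: ifP => // hr.
by rewrite subSS; apply: coef_partprod_le => //; lia.
Qed.

Lemma dpart_ge0 n : 0 <= dpart n.
Proof. by rewrite -(coef_partprod2 n n.+1) //; apply: coef_partprod_ge0. Qed.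

(** The index 0 is excluded because [dpart 0] is 1 while [dpart 1] is 0. *)
Lemma dpart_le i j : (0 < i <= j)%N -> dpart i <= dpart j.
Proof.
move=> /andP[i0]; elim: j => [|j IH]; first by rewrite leqn0 => /eqP->.
rewrite leq_eqVlt => /predU1P[->//|hj]; apply: le_trans (IH _) _ => //.
rewrite -(coef_partprod2 j.+1 j) //; [|lia..].
rewrite -(coef_partprod2 j.+1 j.+1) //.
by apply: coef_partprod_shift; lia.
Qed.

Lemma dpart0 : dpart 0 = 1.
Proof. by rewrite -(coef_partprod2 0 1) // partprod_nil. Qed.

Lemma dpart2 : dpart 2 = 1.
Proof.
rewrite -(coef_partprod2 2 2) // coef_partprodS //= partprod_nil // add0r.
by rewrite (coef_partprod2 2 2) // dpart0.
Qed.

Lemma dpart_gt0 n : (1 < n)%N -> 0 < dpart n.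
Proof. by move=> hn; rewrite (@lt_le_trans _ _ (dpart 2)) ?dpart_le // dpart2. Qed.

(** The truncation of [r 'X^r / (1 - 'X^r)], which is ['X G' / G] for [G = 1 / (1 - 'X^r)]. *)
Definition logder (B r : nat) : {poly int} := \sum_(1 <= e < B.+1) r%:R *: 'X^(r * e).

Lemma eq_uptoMl n (p q u : {poly int}) : eq_upto n p q -> eq_upto n (u * p) (u * q).
Proof. by move=> h; apply: eq_uptoM. Qed.

(** Up to degree [B], [1 - 'X^r] is an inverse of [geom B r]. Multiplied by it, the left side
    becomes [r 'X^r G] by differentiating [geomP] ([h4]), and [logder B r] becomes [r 'X^r]
    ([h3]). *)
Lemma geom_logder B r : (0 < r)%N ->
  eq_upto B ('X * (geom B r)^`()) (geom B r * logder B r).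
Proof.
move=> r0; set G := geom B r.
have small k i : (i <= B)%N -> 'X^(r * B.+1 + k) `_ i = 0 :> int.
  by move=> hi; rewrite coefXn; case: eqP => // h; nia.
have h1 : eq_upto B ((1 - 'X^r) * G) 1.
  by move=> i hi; rewrite geomP coefB -(addn0 (r * B.+1)%N) small // subr0.
have h2 : (1 - 'X^r) * logder B r = r%:R *: ('X^r - 'X^(r * B.+1)).
  have -> : logder B r = r%:R *: ('X^r * \sum_(i < B) 'X^r ^+ i).
    rewrite /logder -scaler_sumr; congr (_ *: _); rewrite big_add1 big_mkord mulr_sumr.
    by apply: eq_bigr => i _; rewrite -exprS exprM.
  rewrite -scalerAr; congr (_ *: _).
  rewrite mulrCA -[X in 'X^r * X]opprK -mulNr opprB -subrX1 opprB mulrBr mulr1.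
  by rewrite -exprS exprM.
have h3 : eq_upto B ((1 - 'X^r) * logder B r) (r%:R *: 'X^r).
  by move=> i hi; rewrite h2 !coefZ coefB -(addn0 (r * B.+1)%N) small // subr0.
have h4 : eq_upto B ((1 - 'X^r) * ('X * G^`())) (r%:R *: 'X^r * G).
  move=> i hi.
  have := congr1 (fun p : {poly int} => ('X * p^`())`_i) (geomP B r).
  rewrite /= derivM !derivB !derivXn -polyC1 derivC !polyC1 !sub0r -/G.
  rewrite mulrDr mulNr !mulrN coefD !coefN.
  rewrite mulrnAr -exprS prednK; last by nia.
  rewrite coefMn -(addn0 (r * B.+1)%N) small // mul0rn oppr0.
  move/eqP; rewrite addrC subr_eq0 => /eqP.
  rewrite mulrCA => ->; congr (_`_i).
  by rewrite -scaler_nat -scalerAl -scalerAr mulrA -exprS prednK // -scalerAl //.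
have e1 : eq_upto B ('X * G^`()) (G * ((1 - 'X^r) * ('X * G^`()))).
  move=> i hi; rewrite mulrA (mulrC G) -{1}['X * _]mul1r.
  by apply/esym; apply: eq_uptoM hi.
have e2 : eq_upto B (G * logder B r) (G * G * ((1 - 'X^r) * logder B r)).
  move=> i hi; rewrite -mulrA; move: i hi; apply: eq_uptoMl => i hi.
  rewrite mulrA (mulrC G) -{1}[logder B r]mul1r.
  by apply/esym; apply: eq_uptoM hi.
move=> i hi; rewrite e1 // e2 // -mulrA.
move: i hi; apply: eq_uptoMl => i hi; rewrite h4 // mulrC.
by apply/esym; move: i hi; apply: eq_uptoMl.
Qed.

Lemma partprod_logder a B r : (0 < a)%N ->
  eq_upto B ('X * (partprod a B r)^`())
            (partprod a B r * \sum_(a <= d < r.+1) logder B d).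
Proof.
move=> a0; elim: r => [|r IH].
  by move=> i _; rewrite /partprod !big_geq // -polyC1 derivC !mulr0 coef0.
have [har|har] := leqP a r.+1; last first.
  by move=> i _; rewrite /partprod !big_geq // -polyC1 derivC !mulr0 coef0.
rewrite /partprod !(big_nat_recr r.+1) //= -/(partprod a B r).
move=> i hi; rewrite derivM mulrDr !mulrDr !coefD mulrA; congr (_ + _).
  rewrite (mulrAC _ (geom B r.+1)); exact: eq_uptoM hi.
rewrite mulrCA -mulrA; apply: (eq_uptoMl B) hi; exact: geom_logder.
Qed.

Lemma dpart_rec n : (0 < n)%N ->
  n%:Z * dpart n = \sum_(2 <= d < n.+1) \sum_(1 <= e < n.+1)
    (if (d * e <= n)%N then d%:Z * dpart (n - d * e) else 0).
Proof.
move=> n0; have := @partprod_logder 2 n n isT n (leqnn n).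
rewrite coefXM coef_deriv (negbTE (lt0n_neq0 n0)) prednK // coef_partprod2 //.
rewrite -mulr_natl natz => ->; rewrite mulr_sumr coef_sum; apply: eq_bigr => d _.
rewrite /logder mulr_sumr coef_sum; apply: eq_bigr => e _.
rewrite -scalerAr coefZ coefMXn ltnNge; case: leqP => h; rewrite ?mulr0 //.
by rewrite coef_partprod2 ?leq_subr ?natz.
Qed.

(** Write [1 - 'X^l] as [1 - 'X] times [1 + ... + 'X^(l-1)]; the factor [1 - 'X] turns the partition
    series into that of [dpart]. *)
Lemma garvan_rankE k (m : int) n : (0 < k)%N ->
  garvan_rank k m n = \sum_(1 <= l < n.+2) (-1) ^+ l.-1 *
    \sum_(i < l) (if (rank_exp k `|m| l + i <= n)%N
                   then dpart (n - (rank_exp k `|m| l + i)) else 0).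
Proof.
move=> k0; rewrite /garvan_rank /rank_gfun -/(partprod 1 n n) mulr_sumr coef_sum.
apply: eq_bigr => l _; rewrite -scalerAr coefZ; congr (_ * _).
rewrite mulrCA coefXnM; case: ltnP => h.
  by rewrite big1 // => i _; case: leqP => //; lia.
have -> : 1 - 'X^l = (1 - 'X) * \sum_(i < l) 'X^i :> {poly int}.
  rewrite -{1}(expr1n {poly int} l) subrXX; congr (_ * _).
  by apply: eq_bigr => i _; rewrite expr1n mul1r.
rewrite mulrA (mulrC _ (1 - 'X)) mulr_sumr coef_sum.
apply: eq_bigr => i _; rewrite coefMXn.
rewrite -subnDA leqNgt; case: ltnP => h1; case: ltnP => h2 //=; try lia.
by rewrite coef_1subX_partprod //; lia.
Qed.

(** * A lower bound for the sum of the inverse squares *)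

Lemma ge0_of_derive_ge0 (R : realType) (f df : R -> R) (b : R) :
  (forall x : R, is_derive x 1 f (df x)) -> (forall x : R, 0 < x < b -> 0 <= df x) ->
  f 0 = 0 -> forall x, 0 <= x <= b -> 0 <= f x.
Proof.
move=> fd df0 f0 x /andP[x0 xb]; rewrite -f0.
apply: (@ger0_derive1_ndecr R f 0 b) => //.
- by move=> y; rewrite in_itv /= => /df0; rewrite derive1E derive_val.
- by apply: derivable_within_continuous.
Qed.

(** The difference vanishes at 0 and has derivative [x * sin x]. This is the bound [cot x <= 1 / x]
    behind [basel_lower]. *)
Lemma mulr_cos_le_sin (R : realType) (x : R) : 0 <= x <= pi -> x * cos x <= sin x.
Proof.
move=> hx; rewrite -subr_ge0.
apply: (@ge0_of_derive_ge0 R (fun x => sin x - x * cos x) (fun x => x * sin x) pi) hx.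
- move=> y; apply: is_derive_eq; rewrite /GRing.scale /=; lra.
- move=> y /andP[y0 yp]; rewrite mulr_ge0 ?sin_ge0_pi ?(ltW y0) ?(ltW yp) //.
- by rewrite sin0 mul0r subrr.
Qed.

(* The error must be cubic: a term of order [1 / x] in [geom_weight_ge] would cost a
   logarithmic factor in [sum_geom_weight_ge]. *)
Lemma expR_le_pade (R : realType) (x : R) : 0 <= x < 2 -> expR x <= (2 + x) / (2 - x).
Proof.
move=> /andP[x0 x2]; rewrite ler_pdivlMr ?subr_gt0 // -subr_ge0.
apply: (@ge0_of_derive_ge0 R (fun x => 2 + x - expR x * (2 - x))
  (fun x => 1 - expR x * (1 - x)) 2); last by rewrite x0 ltW.
- move=> y; apply: is_derive_eq; rewrite /GRing.scale /=; lra.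
- move=> y _; rewrite subr_ge0 -ler_pdivlMl ?expR_gt0 // mulr1 -expRN.
  exact: expR_ge1Dx.
- by rewrite expR0; lra.
Qed.

Lemma sin_cos_gt0 (R : realType) (N k : nat) : (0 < k < N)%N ->
  let x : R := k%:R * pi / (2 * N)%:R in [/\ 0 < x, x < pi / 2, 0 < sin x & 0 < cos x].
Proof.
move=> /andP[k0 kN] x; have p0 := pi_gt0 R.
have hk : 0 < k%:R :> R by rewrite ltr0n.
have hN : 0 < N%:R :> R by rewrite ltr0n; lia.
have x0 : 0 < x by rewrite divr_gt0 ?mulr_gt0 // ltr0n; lia.
have xp : x < pi / 2.
  rewrite ltr_pdivrMr ?ltr0n ?natrM; last lia.
  have : k%:R * pi < N%:R * pi :> R by rewrite ltr_pM2r // ltr_nat.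
  lra.
split=> //; first by apply: sin_gt0_pihalf; rewrite x0.
by apply: cos_gt0_pihalf; rewrite xp andbT (lt_trans _ x0) // oppr_lt0 divr_gt0.
Qed.

(** The reflection of [k] to [N - k] exchanges sine and cosine. *)
Lemma sum_sinV2_half (R : realType) (N : nat) : (0 < N)%N ->
  \sum_(1 <= k < N) (cos (k%:R * pi / (2 * N)%:R)) ^- 2 =
  \sum_(1 <= k < N) (sin (k%:R * pi / (2 * N)%:R)) ^- 2 :> R.
Proof.
move=> N0; rewrite big_nat_rev big_nat [RHS]big_nat; apply: eq_bigr => k hk.
rewrite add1n subSS natrB; last lia.
have Nr : N%:R != 0 :> R by rewrite pnatr_eq0; lia.
have -> : (N%:R - k%:R) * pi / (2 * N)%:R = pi / 2 - k%:R * pi / (2 * N)%:R :> R.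
  by rewrite natrM; field.
by rewrite cosB cos_pihalf sin_pihalf mul0r add0r mul1r.
Qed.

(* [1 / sin^2 x + 1 / cos^2 x = 4 / sin^2 (2 x)], with [cos x = sin (x + pi / 2)]. *)
Lemma sum_sinV2S (R : realType) (N : nat) : (0 < N)%N ->
  let S M := \sum_(1 <= k < M) (sin (k%:R * pi / M%:R)) ^- 2 : R in
  S (2 * N)%N = 4 * S N + 1 /\
  \sum_(1 <= k < N) (sin (k%:R * pi / (2 * N)%:R)) ^- 2 = 2 * S N.
Proof.
move=> N0 /=; set H := \sum_(1 <= k < N) (sin (k%:R * pi / (2 * N)%:R)) ^- 2.
have Nr : N%:R != 0 :> R by rewrite pnatr_eq0; lia.
have hS : \sum_(1 <= k < 2 * N) (sin (k%:R * pi / (2 * N)%:R)) ^- 2 = 2 * H + 1 :> R.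
  rewrite (big_cat_nat (n := N)) //=; [|lia].
  rewrite [X in _ + X]big_ltn; last lia.
  have -> : N%:R * pi / (2 * N)%:R = pi / 2 :> R by rewrite natrM; field.
  rewrite sin_pihalf -/H expr1n invr1.
  suff -> : \sum_(N.+1 <= k < 2 * N) (sin (k%:R * pi / (2 * N)%:R)) ^- 2 = H by ring.
  rewrite /H -(sum_sinV2_half R N) // -(addn1 N) addnC big_addn.
  have -> : (2 * N - N = N)%N by lia.
  apply: eq_bigr => k _.
  have -> : (k + N)%:R * pi / (2 * N)%:R = k%:R * pi / (2 * N)%:R + pi / 2 :> R.
    by rewrite natrD natrM; field.
  by rewrite sinDpihalf.
have hH : H = 2 * \sum_(1 <= k < N) (sin (k%:R * pi / N%:R)) ^- 2.
  suff : H + H = 4 * \sum_(1 <= k < N) (sin (k%:R * pi / N%:R)) ^- 2 by lra.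
  rewrite {2}/H -sum_sinV2_half // -big_split /= mulr_sumr.
  rewrite big_nat [RHS]big_nat; apply: eq_bigr => k hk.
  have -> : k%:R * pi / N%:R = (k%:R * pi / (2 * N)%:R) *+ 2 :> R.
    by rewrite natrM -mulr_natl; field.
  have [_ _] := sin_cos_gt0 R _ _ hk.
  set x := k%:R * pi / (2 * N)%:R => s0 c0.
  have -> : sin (x *+ 2) = 2 * (cos x * sin x) by rewrite sin_mulr2n mulr_natl.
  have := cos2Dsin2 x; have := lt0r_neq0 s0; have := lt0r_neq0 c0.
  move: (sin x) (cos x) => u v v0 u0 huv.
  have -> : 4 * (2 * (v * u)) ^- 2 = (v ^+ 2 + u ^+ 2) / (u ^+ 2 * v ^+ 2) :> R.
    by rewrite huv; field; rewrite u0 v0.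
  by field; rewrite u0 v0.
by rewrite hS -hH hH; split => //; ring.
Qed.

(** The doubling relation [S (2 N) = 4 S N + 1] determines the sum at powers of two, whence the form
    [2 ^ t] of the cutoff from here on. *)
Lemma sum_sinV2 (R : realType) (t : nat) :
  \sum_(1 <= k < 2 ^ t) (sin (k%:R * pi / (2 ^ t)%:R)) ^- 2 =
  ((2 ^ t)%:R ^+ 2 - 1) / 3 :> R.
Proof.
elim: t => [|t IH]; first by rewrite big_geq // expr1n subrr mul0r.
rewrite expnS; have [|-> _] := sum_sinV2S R (2 ^ t); first by rewrite expn_gt0.
by rewrite IH natrM; field.
Qed.

(** At [x = k pi / (2 N)] one has [1 / sin^2 x = cot^2 x + 1 <= 1 / x^2 + 1]. Summed over [k < N],
    the left side is [2 (N^2 - 1) / 3]. *)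
Lemma basel_lower (R : realType) (t : nat) :
  pi ^+ 2 / 6 * (1 - 3 / (2 * (2 ^ t)%:R)) <= \sum_(1 <= k < 2 ^ t) k%:R ^- 2 :> R.
Proof.
set N := (2 ^ t)%N; have N0 : (0 < N)%N by rewrite expn_gt0.
have Nr : 0 < N%:R :> R by rewrite ltr0n.
have p0 := pi_gt0 R.
have pn : pi != 0 :> R := lt0r_neq0 p0.
have Nn : N%:R != 0 :> R := lt0r_neq0 Nr.
have [_] := sum_sinV2S R N N0; rewrite sum_sinV2 -/N => hH.
have hle : \sum_(1 <= k < N) (sin (k%:R * pi / (2 * N)%:R)) ^- 2 <=
    \sum_(1 <= k < N) ((2 * N%:R / pi) ^+ 2 * k%:R ^- 2 + 1) :> R.
  apply: ler_sum_nat => k hk; have [] := sin_cos_gt0 R _ _ hk.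
  have kr : k%:R != 0 :> R by rewrite pnatr_eq0; lia.
  set x := k%:R * pi / (2 * N)%:R => x0 xp s0 c0.
  have -> : (2 * N%:R / pi) ^+ 2 * k%:R ^- 2 = x ^- 2.
    by rewrite /x natrM; move: (pi : R) pn => P pn; field; rewrite ?kr ?pn ?Nn.
  clearbody x.
  have hx : x * cos x <= sin x.
    by apply: mulr_cos_le_sin; apply/andP; split; lra.
  have -> : sin x ^- 2 = cos x ^+ 2 / sin x ^+ 2 + 1.
    by rewrite cos2sin2; field; rewrite lt0r_neq0.
  have -> : x ^- 2 = cos x ^+ 2 / (x * cos x) ^+ 2 by field; rewrite !lt0r_neq0.
  rewrite lerD2r ler_pM2l ?exprn_gt0 // lef_pV2 ?posrE ?exprn_gt0 ?mulr_gt0 //.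
  by rewrite ler_pXn2r // nnegrE ?mulr_ge0 // ltW.
move: hle; rewrite hH big_split /= -mulr_sumr.
rewrite sumr_const_nat; move: (\sum_(1 <= k < N) _) => T.
rewrite natrB // => h.
have p2 : 0 < pi ^+ 2 :> R by rewrite exprn_gt0.
have -> : pi ^+ 2 / 6 * (1 - 3 / (2 * N%:R)) =
  (2 * N%:R / pi) ^- 2 * ((2 * N%:R ^+ 2 - 3 * N%:R) / 3) :> R.
  by move: (pi : R) pn => P pn; field; rewrite ?pn ?Nn.
rewrite ler_pdivrMl; last by rewrite exprn_gt0 // divr_gt0 // mulr_gt0.
move: h; set W := _ ^+ 2; lra.
Qed.

(** * The renewal inequality *)

(** The right side is [1 / w^2] with [w = 2 sinh (x / 2)]. The bound [expR_le_pade] at [u = x / 2]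
    gives [w <= 8 u / (4 - u^2)], and the inverse square of this bound is
    [1 / x^2 - 1/8 + (u / 8)^2]. *)
Lemma geom_weight_ge (R : realType) (x : R) : 0 < x <= 2 ->
  x ^- 2 - 8^-1 <= expR (- x) / (1 - expR (- x)) ^+ 2.
Proof.
move=> /andP[x0 x2]; set u := x / 2; set E := expR u.
have [u0 u1] : 0 < u /\ u <= 1 by rewrite /u; lra.
have E1 : 1 < E by rewrite expR_gt1.
have E0 : 0 < E by apply: lt_trans E1.
have -> : expR (- x) = E ^- 2.
  by rewrite expRN; congr (_^-1); rewrite -expRM_natl; congr expR; rewrite /u; lra.
have hE : E <= (2 + u) / (2 - u) by apply: expR_le_pade; apply/andP; split; lra.
set w := E - E^-1.
have w0 : 0 < w by rewrite subr_gt0 (lt_trans _ E1) // invf_lt1.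
have -> : E ^- 2 / (1 - E ^- 2) ^+ 2 = w ^- 2.
  have E2 : E ^+ 2 - 1 != 0.
    by rewrite lt0r_neq0 // subr_gt0 expr_gt1 // ltW.
  by rewrite /w; field; rewrite E2 lt0r_neq0.
have hw : w <= 8 * u / (4 - u ^+ 2).
  have hV : (2 - u) / (2 + u) <= E^-1.
    by rewrite -[leLHS]invrK lef_pV2 ?posrE ?invr_gt0 ?divr_gt0 ?invf_div //; lra.
  have -> : 8 * u / (4 - u ^+ 2) = (2 + u) / (2 - u) - (2 - u) / (2 + u).
    by field; rewrite !lt0r_neq0 //; nra.
  by rewrite lerB.
have hw2 : (8 * u / (4 - u ^+ 2)) ^- 2 <= w ^- 2.
  have q0 : 0 < 8 * u / (4 - u ^+ 2) by apply: lt_le_trans hw.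
  by rewrite lef_pV2 ?posrE ?exprn_gt0 // ler_pXn2r // nnegrE ltW.
apply: le_trans hw2; rewrite exprMn exprVn invf_div.
have -> : x = 2 * u by rewrite /u; field.
rewrite -subr_ge0.
have -> : (4 - u ^+ 2) ^+ 2 / (8 * u) ^+ 2 - ((2 * u) ^- 2 - 8^-1) = (u / 8) ^+ 2.
  by field; rewrite lt0r_neq0.
exact: sqr_ge0.
Qed.

(** With [y = expR (- (s e))], the summand is the full series of [d y^d] over [d >= 2]. For
    [N = 2 ^ t], which lies between [1 / s] and [2 / s], the truncation in [basel_lower] costs at
    most [4 / s], and the loss of [9/8] per term at most [9 / (4 s)]; together less than [7 / s]. *)
Lemma sum_geom_weight_ge (R : realType) (s : R) (t : nat) :
  0 < s -> 1 <= s * (2 ^ t)%:R <= 2 ->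
  pi ^+ 2 / (6 * s ^+ 2) - 7 / s <=
  \sum_(1 <= e < 2 ^ t)
    (expR (- (s * e%:R)) / (1 - expR (- (s * e%:R))) ^+ 2 - expR (- (s * e%:R))).
Proof.
move=> s0; have := @basel_lower R t; set N := (2 ^ t)%N => hB /andP[h1 h2].
have Nr : 0 < N%:R :> R by rewrite ltr0n expn_gt0.
have hterm : \sum_(1 <= e < N) (s ^- 2 * e%:R ^- 2 - 9 / 8) <=
  \sum_(1 <= e < N)
    (expR (- (s * e%:R)) / (1 - expR (- (s * e%:R))) ^+ 2 - expR (- (s * e%:R))).
  apply: ler_sum_nat => e /andP[e1 eN].
  have e0 : 0 < e%:R :> R by rewrite ltr0n.
  have x0 : 0 < s * e%:R by rewrite mulr_gt0.
  have := @geom_weight_ge R (s * e%:R); rewrite x0 /= => /(_ _).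
  have -> : s * e%:R <= 2.
    by apply: le_trans h2; rewrite ler_pM2l // ler_nat ltnW.
  move=> /(_ isT); have : expR (- (s * e%:R)) <= 1 by rewrite expR_le1 oppr_le0 ltW.
  rewrite exprMn invfM; lra.
apply: le_trans hterm; rewrite big_split /= -mulr_sumr sumr_const_nat.
move: (\sum_(1 <= k < N) _) hB => T hB.
have p4 : pi ^+ 2 / 6 * (3 / 2) <= 4 :> R.
  have := pihalf_lt2 R; have := pi_gt0 R; nra.
have s2 : 0 < s ^- 2 by rewrite invr_gt0 exprn_gt0.
have hT : s ^- 2 * (pi ^+ 2 / 6 - 4 / N%:R) <= s ^- 2 * T.
  rewrite ler_pM2l //; apply: le_trans hB.
  have -> : pi ^+ 2 / 6 * (1 - 3 / (2 * N%:R)) =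
      pi ^+ 2 / 6 - pi ^+ 2 / 6 * (3 / 2) / N%:R :> R.
    by move: (pi : R) => P; field; rewrite lt0r_neq0.
  by rewrite lerD2l lerN2 ler_pM2r ?invr_gt0.
have hN : s ^- 2 * (4 / N%:R) <= 4 / s.
  rewrite mulrA ler_pdivrMr // -subr_ge0.
  have -> : 4 / s * N%:R - s ^- 2 * 4 = 4 * s ^- 2 * (s * N%:R - 1).
    by field; rewrite lt0r_neq0.
  by rewrite !mulr_ge0 ?subr_ge0 // ltW.
have hN2 : N%:R <= 2 / s by rewrite ler_pdivlMr // mulrC.
have -> : pi ^+ 2 / (6 * s ^+ 2) = s ^- 2 * (pi ^+ 2 / 6) :> R.
  by move: (pi : R) => P; field; rewrite lt0r_neq0.
rewrite mulrBr in hT.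
have -> : - (9 / 8) *+ (N - 1) = - (9 / 8) * (N%:R - 1) :> R.
  by rewrite -[LHS]mulr_natr natrB ?expn_gt0.
have si : 0 < s^-1 by rewrite invr_gt0.
lra.
Qed.

Lemma sum_mul_geom (R : fieldType) (y : R) (D : nat) : y != 1 ->
  \sum_(1 <= d < D.+1) d%:R * y ^+ d =
  y / (1 - y) ^+ 2 - y ^+ D.+1 * (1 + D%:R * (1 - y)) / (1 - y) ^+ 2.
Proof.
move=> y1; have {}y1 : 1 - y != 0 by rewrite subr_eq0 eq_sym.
elim: D => [|D IH].
  by rewrite big_geq // expr1 mul0r addr0 mulr1 subrr.
rewrite big_nat_recr //= IH -natr1 !exprS; field.
by [].
Qed.

(* The terms lost beyond [D] are dominated by those of the window [(D-h, D]]. *)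
Lemma window_sum_ge (R : realFieldType) (y c : R) (h D : nat) (G : nat -> R) :
  0 < y < 1 -> 0 <= c -> (0 < h)%N -> (2 * h <= D)%N -> 1 <= 6 * h%:R * (1 - y) ->
  (forall d, (1 < d <= D)%N -> c <= G d) ->
  (forall d, (D - h < d <= D)%N -> 49 * c <= G d) ->
  c * (y / (1 - y) ^+ 2 - y) <= \sum_(2 <= d < D.+1) d%:R * y ^+ d * G d.
Proof.
move=> /andP[y0 y1] c0 h0 hD hy hG hW.
have z0 : 0 < 1 - y by rewrite subr_gt0.
have yn d : 0 <= d%:R * y ^+ d by rewrite mulr_ge0 ?exprn_ge0 // ltW.
have split_sum (F : nat -> R) : \sum_(2 <= d < D.+1) F d =
    \sum_(2 <= d < (D - h).+1) F d + \sum_((D - h).+1 <= d < D.+1) F d.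
  by rewrite (big_cat_nat (n := (D - h).+1)) //; lia.
set win := \sum_((D - h).+1 <= d < D.+1) d%:R * y ^+ d.
have h1 : c * \sum_(2 <= d < D.+1) d%:R * y ^+ d + 48 * c * win <=
    \sum_(2 <= d < D.+1) d%:R * y ^+ d * G d.
  rewrite !split_sum -/win.
  have -> : forall a : R, c * (a + win) + 48 * c * win = a * c + win * (49 * c).
    by move=> a; ring.
  apply: lerD; rewrite mulr_suml; apply: ler_sum_nat => d hd.
    by apply: ler_wpM2l => //; apply: hG; lia.
  by apply: ler_wpM2l => //; apply: hW; lia.
apply: le_trans h1.
have -> : \sum_(2 <= d < D.+1) d%:R * y ^+ d =
    y / (1 - y) ^+ 2 - y ^+ D.+1 * (1 + D%:R * (1 - y)) / (1 - y) ^+ 2 - y.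
  rewrite -sum_mul_geom ?lt_eqF // [in RHS]big_ltn; last lia.
  by rewrite mul1r expr1 addrC addKr.
(* The window has [h] terms, each with [d >= D / 2] and [y^d >= y^D]. *)
have hwin : h%:R * D%:R / 2 * y ^+ D <= win.
  have -> : h%:R * D%:R / 2 * y ^+ D =
      \sum_((D - h).+1 <= d < D.+1) (D%:R / 2 * y ^+ D) :> R.
    rewrite sumr_const_nat -mulr_natl subSS subKn; last lia.
    by ring.
  apply: ler_sum_nat => d hd; apply: ler_pM.
  - by rewrite divr_ge0.
  - by rewrite exprn_ge0 // ltW.
  - by rewrite ler_pdivrMr // mulrC -natrM ler_nat; lia.
  - by rewrite ler_wiXn2l ?ltW //; lia.
(* Put [z = 1 - y]. From [6 h z >= 1] and [2 h <= D] follow [1 <= 36 h^2 z^2 <= 18 h D z^2] and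
   [D z <= 6 h D z^2], hence the 24 below. Twice 24 gives 48, and [49 = 1 + 48]. *)
have htail : y ^+ D.+1 * (1 + D%:R * (1 - y)) / (1 - y) ^+ 2 <= 48 * win.
  have hr : 0 < h%:R :> R by rewrite ltr0n.
  have hDr : 2 * h%:R <= D%:R :> R by rewrite -natrM ler_nat.
  have yD : 0 < y ^+ D by rewrite exprn_gt0.
  apply: (@le_trans _ _ (24 * h%:R * D%:R * y ^+ D)); last by lra.
  rewrite ler_pdivrMr ?exprn_gt0 //.
  apply: (@le_trans _ _ (y ^+ D * (1 + D%:R * (1 - y)))).
    rewrite ler_wpM2r ?addr_ge0 ?mulr_ge0 ?(ltW z0) //.
    by rewrite exprS ler_piMl ?(ltW yD) ?(ltW y1).
  rewrite [leRHS](_ : _ = y ^+ D * (24 * h%:R * D%:R * (1 - y) ^+ 2)); last by ring.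
  rewrite ler_pM2l //.
  set z := 1 - y in z0 hy *; set H : R := h%:R in hr hDr hy *.
  set d : R := D%:R in hDr *.
  have a1 : 1 <= (6 * H * z) ^+ 2 by rewrite expr_ge1 // ltW // (lt_le_trans ltr01).
  have a2 : H * (H * z ^+ 2) <= d / 2 * (H * z ^+ 2).
    by rewrite ler_wpM2r ?mulr_ge0 ?sqr_ge0 ?(ltW hr) //; lra.
  have a3 : d * z <= d * z * (6 * H * z).
    by rewrite ler_peMr // mulr_ge0 ?(ltW z0) // ler0n.
  nra.
nra.
Qed.

Lemma sum_nat_sub (R : numDomainType) (a b c : nat) (F : nat -> R) :
  (a <= b <= c)%N -> (forall i, 0 <= F i) ->
  \sum_(a <= i < b) F i <= \sum_(a <= i < c) F i.
Proof.
move=> /andP[ab bc] F0; rewrite [leRHS](big_cat_nat (n := b)) //=.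
by rewrite lerDl sumr_ge0.
Qed.

(** All terms of [dpart_rec] are nonnegative, so those with [e >= N] or [d * e > x] may be dropped.
    In the application [x = m - i], so the jumps kept do not go below [i]. *)
Lemma dpart_rec_ge (R : realType) (m x N : nat) : (x <= m)%N -> (0 < m)%N -> (N <= m)%N ->
  \sum_(1 <= e < N) \sum_(2 <= d < (x %/ e).+1) d%:R * (dpart (m - d * e))%:~R
  <= m%:R * (dpart m)%:~R :> R.
Proof.
move=> xm m0 Nm; have := congr1 (fun z : int => z%:~R : R) (dpart_rec m m0).
rewrite rmorphM /= -pmulrn => ->; rewrite exchange_big /= rmorph_sum /=.
pose F e : R := (\sum_(2 <= d < m.+1)
  (if (d * e <= m)%N then d%:Z * dpart (m - d * e) else 0))%:~R.
have t0 e d : 0 <= (if (d * e <= m)%N then d%:Z * dpart (m - d * e) else 0).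
  by case: ifP => // _; rewrite mulr_ge0 ?dpart_ge0.
have F0 e : 0 <= F e by rewrite ler0z; apply: sumr_ge0 => d _; exact: t0.
have [N0|N0] := posnP N.
  by rewrite N0 big_geq //; apply: sumr_ge0 => e _; exact: F0.
apply: le_trans (sum_nat_sub R 1 N m.+1 F _ F0); last lia.
apply: ler_sum_nat => e /andP[e1 eN]; rewrite /F rmorph_sum /=.
have hx : (x %/ e <= m)%N by apply: leq_trans (leq_div _ _) xm.
have [hx1|hx1] := leqP (x %/ e) 0.
  by rewrite big_geq; [apply: sumr_ge0 => d _; rewrite ler0z|lia].
apply: le_trans (sum_nat_sub R 2 (x %/ e).+1 m.+1 _ _ _); last 2 first.
- by lia.
- by move=> d; rewrite ler0z.
apply: ler_sum_nat => d /andP[d2 dx]; rewrite ifT; last first.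
  by have := leq_divM x e; nia.
by rewrite rmorphM /= -pmulrn.
Qed.

(** Take [h = N %/ e]: then [h] steps of size [e] cover between half of [N] and [N]. *)
Lemma divn_window (N x e : nat) : (0 < e < N)%N -> (2 * N <= x)%N ->
  exists h, [/\ (0 < h)%N, (2 * h <= x %/ e)%N, (N <= 2 * h * e)%N & (h * e <= N)%N].
Proof.
move=> /andP[e0 eN] hx; have hN := leq_divM N e; have hN2 := ltn_ceil N e0.
have h0 : (0 < N %/ e)%N by rewrite divn_gt0 // ltnW.
exists (N %/ e)%N; split=> //; first by rewrite leq_divRL // -mulnA; lia.
by move: (N %/ e)%N hN2 h0 => h; nia.
Qed.

(** Uses [1 - expR (- z) >= z / (1 + z) >= z / 3]; it supplies the width condition of
    [window_sum_ge]. *)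
Lemma window_width (R : realType) (z H : R) : 0 < z -> z <= 2 -> 0 <= H ->
  1 <= 2 * H * z -> 1 <= 6 * H * (1 - expR (- z)).
Proof.
move=> z0 z2 H0 h; have hE := expR_ge1Dx z; have E0 := expR_gt0 z.
have h1 : (expR z)^-1 <= (1 + z)^-1 by rewrite lef_pV2 ?posrE //; lra.
have h2 : 1 - (1 + z)^-1 = z / (1 + z) by field; lra.
have h3 : z / 3 <= z / (1 + z) by rewrite ler_pM2l // lef_pV2 ?posrE //; lra.
have : 6 * H * (z / 3) <= 6 * H * (1 - expR (- z)).
  by rewrite ler_wpM2l ?mulr_ge0 // expRN; lra.
lra.
Qed.

Lemma dpart_ratio (R : realType) (s : R) (t n i m : nat) :
  0 < s -> 1 <= s * (2 ^ t)%:R <= 2 -> n%:R <= pi ^+ 2 / (6 * s ^+ 2) - 7 / s ->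
  (0 < i <= m)%N -> (m <= n)%N ->
  (dpart i)%:~R <= 49 * expR 4 * expR (- (s * (m - i)%:R)) * (dpart m)%:~R :> R.
Proof.
move=> s0 hN hn; set N := (2 ^ t)%N in hN.
have N0 : (0 < N)%N by rewrite expn_gt0.
have hW := sum_geom_weight_ge R s t s0 hN; rewrite -/N in hW.
clearbody N => {t}; move=> /andP[i0 im] mn.
have f0 j : 0 <= (dpart j)%:~R :> R by rewrite ler0z dpart_ge0.
(* The factor [expR (- 4)] pays for the growth of [expR (s (j - i))] over two windows, as
   [s N <= 2]; the 49 is the surplus that [window_sum_ge] requires. *)
set c : R := (dpart i)%:~R * expR (- 4) / 49.
have ci : (dpart i)%:~R = 49 * expR 4 * c :> R.
  by rewrite /c expRN; field; rewrite lt0r_neq0 ?expR_gt0.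
have c0 : 0 <= c by rewrite /c divr_ge0 // mulr_ge0 ?f0 ?expR_ge0.
have ci49 : 49 * c <= (dpart i)%:~R.
  have : 1 <= expR 4 :> R by rewrite -[leLHS]expR0 ler_expR.
  by rewrite ci; nra.
have hsN : s * N%:R <= 2 by case/andP: hN.
(* Within two windows of [i] monotonicity suffices. *)
have near j : (i <= j)%N -> (j - i <= 2 * N)%N ->
    49 * c * expR (s * (j - i)%:R) <= (dpart j)%:~R.
  move=> ij hj; apply: (@le_trans _ _ (dpart i)%:~R).
    rewrite ci -[leLHS]mulrA -[leRHS]mulrA ler_pM2l // mulrC ler_wpM2r // ler_expR.
    have : (j - i)%:R <= 2 * N%:R :> R by rewrite -natrM ler_nat.
    nra.
  by rewrite ler_int dpart_le // i0.
suff key : c * expR (s * (m - i)%:R) <= (dpart m)%:~R.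
  rewrite ci expRN -[leRHS]mulrA ler_pM2l ?mulr_gt0 ?expR_gt0 //.
  by rewrite ler_pdivlMl ?expR_gt0 // mulrC.
elim/ltn_ind: m im mn => m IH im mn.
have [hm|hm] := leqP (m - i) (2 * N).
  apply: le_trans (near m im hm); rewrite ler_wpM2r ?expR_ge0 //; lra.
set x := (m - i)%N in hm *.
have m0 : (0 < m)%N by lia.
rewrite -(@ler_pM2l _ m%:R) ?ltr0n //.
apply: le_trans (@dpart_rec_ge R m x N _ m0 _); [|lia..].
(* The total weight is at least [n], hence at least [m]; it remains to compare the sums separately
   for each [e]. *)
apply: (@le_trans _ _ (expR (s * x%:R) * c * (\sum_(1 <= e < N)
    (expR (- (s * e%:R)) / (1 - expR (- (s * e%:R))) ^+ 2 - expR (- (s * e%:R)))))).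
  rewrite mulrC (mulrC c) ler_wpM2l ?mulr_ge0 ?expR_ge0 //.
  by apply: le_trans hW; apply: le_trans hn; rewrite ler_nat.
rewrite mulr_sumr; apply: ler_sum_nat => e /andP[e1 eN].
set y := expR (- (s * e%:R)).
have er : 0 < e%:R :> R by rewrite ltr0n.
have se0 : 0 < s * e%:R by rewrite mulr_gt0.
have [|h [h0 hD hNh hhN]] := divn_window N x e _ (ltnW hm); first by rewrite e1.
have hDe := leq_divM x e; have hDe2 := ltn_ceil x e1.
move: (x %/ e)%N hD hDe hDe2 => D hD hDe hDe2.
have hdx d : (d <= D)%N -> (d * e <= x)%N.
  by move=> dD; apply: leq_trans hDe; rewrite leq_mul2r dD orbT.
pose G d : R := expR (- (s * (x - d * e)%:R)) * (dpart (m - d * e))%:~R.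
have GE d : (d * e <= x)%N ->
    (dpart (m - d * e))%:~R = expR (s * x%:R) * y ^+ d * G d.
  move=> hd; rewrite /G mulrA /y -expRM_natl -!expRD (natrB _ hd) natrM.
  by rewrite -[LHS]mul1r -expR0; congr (expR _ * _); ring.
have -> : \sum_(2 <= d < D.+1) d%:R * (dpart (m - d * e))%:~R =
    expR (s * x%:R) * \sum_(2 <= d < D.+1) d%:R * y ^+ d * G d.
  rewrite mulr_sumr; apply: eq_big_nat => d /andP[_ dD].
  by rewrite {1}GE ?hdx //; ring.
rewrite -mulrA ler_pM2l ?expR_gt0 //.
have Gge (a : R) d : (d * e <= x)%N ->
    a * expR (s * (m - d * e - i)%:R) <= (dpart (m - d * e))%:~R -> a <= G d.
  move=> hd; have -> : (m - d * e - i = x - d * e)%N by rewrite /x subnAC.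
  by rewrite /G expRN mulrC ler_pdivlMl ?expR_gt0.
apply: (@window_sum_ge R y c h) => //.
- by rewrite expR_gt0 expR_lt1 oppr_lt0.
- apply: window_width => //.
    by rewrite (le_trans _ hsN) // (ler_pM2l s0) ler_nat ltnW.
  have /le_trans -> // : 1 <= s * N%:R by case/andP: hN.
  have -> : 2 * h%:R * (s * e%:R) = s * (2 * h%:R * e%:R) by ring.
  by rewrite (ler_pM2l s0) -!natrM ler_nat.
- move=> d /andP[d1 dD]; have hd := hdx d dD.
  apply: Gge => //; have : (0 < d * e)%N by rewrite muln_gt0 e1 ltnW.
  by move: (d * e)%N hd => q hd q0; apply: IH; clear -m0 hd q0 im mn; lia.
(* Here [d > D - h], so [m - d * e] is less than [N] above [i], and [near] gives the factor 49; the
   previous case used the induction hypothesis. *)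
- move=> d /andP[d1 dD]; have hd := hdx d dD.
  apply: Gge => //; have : (x < d * e + N)%N.
    apply: leq_trans hDe2 _; apply: leq_trans (leq_add (leqnn _) hhN).
    by rewrite -mulnDl leq_mul2r; apply/orP; right; clear -d1; lia.
  by move: (d * e)%N hd => q hd hq; apply: near; clear -hd hq im; lia.
Qed.

(** * Rank counts *)

(** For [i = 0], compare with [dpart 2 = dpart 0]: the shift by 2 costs [expR (2 s) <= expR 4],
    which raises the constant to [expR 8]. *)
Lemma dpart_ratio0 (R : realType) (s : R) (t n i m : nat) :
  0 < s <= 2 -> 1 <= s * (2 ^ t)%:R <= 2 -> n%:R <= pi ^+ 2 / (6 * s ^+ 2) - 7 / s ->
  (i <= m)%N -> (1 < m <= n)%N ->
  (dpart i)%:~R <= 49 * expR 8 * expR (- (s * (m - i)%:R)) * (dpart m)%:~R :> R.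
Proof.
move=> /andP[s0 s2] hN hn im /andP[m1 mn].
have d0 : 0 <= (dpart m)%:~R :> R by rewrite ler0z dpart_ge0.
have [i0|i0] := posnP i; last first.
  apply: le_trans (dpart_ratio R s t n i m s0 hN hn _ mn) _; first by rewrite i0.
  rewrite ler_wpM2r // ler_wpM2r ?expR_ge0 // ler_pM2l // ler_expR; lra.
rewrite i0 dpart0 -dpart2.
apply: le_trans (dpart_ratio R s t n 2 m s0 hN hn _ mn) _ => //.
rewrite ler_wpM2r // -!mulrA ler_pM2l // -!expRD ler_expR subn0 natrB //; lra.
Qed.

Lemma F1E (k a n : nat) :
  F1 k a n = if (a + k <= n.+1)%N then dpart (n.+1 - (a + k)) else 0.
Proof.
rewrite /F1 -PoszD; case: ltngtP => h //.
- have [q ->] : exists q, n = (a + k + q)%N by exists (n - (a + k))%N; lia.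
  have -> : (a + k + q)%N%:Z - (a + k)%:Z = q%:Z by lia.
  have -> : q%:Z + 1 = q.+1%:Z by lia.
  by have -> : ((a + k + q).+1 - (a + k) = q.+1)%N by lia.
- have [q hq] : exists q, n%:Z - (a + k)%:Z + 1 = Negz q by exists (a + k - n.+2)%N; lia.
  have [q' hq'] : exists q, n%:Z - (a + k)%:Z = Negz q by exists (a + k - n.+1)%N; lia.
  by rewrite hq hq'.
- have -> : n%:Z - (a + k)%:Z + 1 = 0 by lia.
  have -> : n%:Z - (a + k)%:Z = Negz 0 by lia.
  by rewrite -h subnn.
Qed.

Lemma rank_exp_lb (k a l : nat) : (0 < k)%N -> (0 < l)%N ->
  (k.-1 + l * a <= rank_exp k a l)%N.
Proof. by move=> k0 l0; rewrite /rank_exp; nia. Qed.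

(** Equality holds at [l = 2], so the condition of case (i) says exactly that the second exponent
    exceeds [n]. *)
Lemma rank_exp_lb2 (k a l : nat) : (0 < k)%N -> (1 < l)%N ->
  (4 * k + 2 * a <= rank_exp k a l + 3)%N.
Proof.
move=> k0 l1; rewrite /rank_exp.
have : (8 * k - 6 <= l * ((2 * k - 1) * l - 1))%N by nia.
by nia.
Qed.

Definition rank_tail (k a n l : nat) : int :=
  \sum_(i < l) (if (rank_exp k a l + i <= n)%N
                then dpart (n - (rank_exp k a l + i)) else 0).

Lemma garvan_rank_split (k : nat) (m : int) (n : nat) : (0 < k)%N ->
  garvan_rank k m n = F1 k `|m| n +
    \sum_(2 <= l < n.+2) (-1) ^+ l.-1 * rank_tail k `|m| n l.
Proof.
move=> k0; rewrite garvan_rankE // big_ltn // expr0 mul1r; congr (_ + _).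
rewrite big_ord1 F1E addn0.
have -> : rank_exp k `|m| 1 = (k.-1 + `|m|)%N by rewrite /rank_exp; lia.
have -> : (`|m| + k <= n.+1)%N = (k.-1 + `|m| <= n)%N by lia.
by case: ifP => // h; congr dpart; lia.
Qed.

Lemma exists_pow2 (R : realType) (s : R) : 0 < s <= 2 ->
  exists t, 1 <= s * (2 ^ t)%:R <= 2.
Proof.
move=> /andP[s0 s2].
have ex : exists t, 1 <= s * (2 ^ t)%:R.
  exists (Num.bound s^-1); rewrite mulrC -ler_pdivrMr // div1r.
  have si : 0 <= s^-1 by rewrite invr_ge0 ltW.
  apply: ltW; apply: lt_trans (archi_boundP si) _.
  by rewrite ltr_nat ltn_expl.
case: (ex_minnP ex) => t ht hmin; exists t; rewrite ht /=.
case: t ht hmin => [|t] ht hmin; first by rewrite expn0 mulr1.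
have : ~~ (1 <= s * (2 ^ t)%:R) by apply/negP => /hmin; rewrite ltnn.
rewrite -ltNge expnS natrM; lra.
Qed.

Lemma sum_succ_geom_le (R : realFieldType) (z : R) (n : nat) : 0 <= z < 1 ->
  \sum_(2 <= l < n.+2) l%:R * z ^+ l.-1 <= 2 * z / (1 - z) ^+ 2.
Proof.
move=> /andP[z0 z1]; rewrite big_add1 /=.
have -> : 2 * z / (1 - z) ^+ 2 = 2 * (z / (1 - z) ^+ 2) by rewrite mulrA.
apply: (@le_trans _ _ (2 * \sum_(1 <= d < n.+1) d%:R * z ^+ d)).
  rewrite mulr_sumr; apply: ler_sum_nat => d /andP[d0 _].
  rewrite mulrA ler_wpM2r ?exprn_ge0 // -natrM ler_nat; lia.
rewrite ler_pM2l // sum_mul_geom ?lt_eqF // gerBl.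
by rewrite divr_ge0 ?sqr_ge0 // mulr_ge0 ?exprn_ge0 // addr_ge0 //
  mulr_ge0 // subr_ge0 ltW.
Qed.

Lemma rank_tail_eq0 (k a n l : nat) : (n < rank_exp k a l)%N -> rank_tail k a n l = 0.
Proof. by move=> h; rewrite /rank_tail big1 // => i _; rewrite ifN //; lia. Qed.

Lemma rank_tail_ge0 (k a n l : nat) : 0 <= rank_tail k a n l.
Proof. by apply: sumr_ge0 => i _; case: ifP => // _; apply: dpart_ge0. Qed.

Lemma garvan_rank_eqF1 (k : nat) (m : int) (n : nat) : (0 < k)%N ->
  (n + 3 < 4 * k + 2 * `|m|)%N -> garvan_rank k m n = F1 k `|m| n.
Proof.
move=> k0 h; rewrite garvan_rank_split // big_nat big1 ?addr0 // => l /andP[l2 _].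
by rewrite rank_tail_eq0 ?mulr0 //; have := rank_exp_lb2 k `|m| l k0 l2; lia.
Qed.

(* [4 / n] is the least shift of the saddle point, up to the constant, for which
   the lower bound [pi^2/(6 s^2) - 7/s] of the total weight exceeds [n]. *)
Lemma saddle_shift (R : realType) (n : nat) : (36 <= n)%N ->
  let s : R := pi / Num.sqrt (6 * n%:R) - 4 / n%:R in
  0 < s <= 2 /\ n%:R <= pi ^+ 2 / (6 * s ^+ 2) - 7 / s.
Proof.
move=> hn s; set N : R := n%:R in s *.
have N36 : 36 <= N by rewrite ler_nat.
have N0 : 0 < N by lra.
set r := Num.sqrt (6 * N) in s *.
have r2 : r ^+ 2 = 6 * N by rewrite sqr_sqrtr //; lra.
have r0 : 0 < r by rewrite sqrtr_gt0; lra.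
have r14 : 14 <= r.
  by rewrite -(@ler_pXn2r _ 2) // ?nnegrE ?(ltW r0) // r2; lra.
have p2 := pi_ge2 R; have p4 := pihalf_lt2 R; have p0 := pi_gt0 R.
have sE : s = (pi - 24 / r) / r.
  by rewrite /s mulrBl; congr (_ - _); rewrite -mulrA -invfM -expr2 r2; field; lra.
have h24 : 24 / r < 2 by rewrite ltr_pdivrMr //; lra.
have s0 : 0 < s by rewrite sE divr_gt0 // subr_gt0; lra.
split.
  rewrite s0 /= sE ler_pdivrMr //.
  have : 0 < 24 / r by rewrite divr_gt0.
  lra.
(* Expanding, [pi^2 / (6 s^2) = N + 8 / s + 16 / (N s^2)], and [8 / s] absorbs [7 / s]. *)
have hp : pi ^+ 2 = 6 * N * (s + 4 / N) ^+ 2 :> R.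
  rewrite /s subrK expr_div_n r2 mulrC divfK //; lra.
have -> : pi ^+ 2 / (6 * s ^+ 2) - 7 / s = N + (s + 16 / N) / s ^+ 2 :> R.
  by rewrite hp; field; rewrite !lt0r_neq0.
have : 0 < 16 / N by rewrite divr_gt0.
rewrite lerDl => h; rewrite divr_ge0 ?sqr_ge0 //; lra.
Qed.

Lemma rank_tail_le (R : realType) (k a n l : nat) :
  (0 < k)%N -> (36 <= n)%N -> (2 * k + 2 <= n)%N -> (2 * a < n)%N -> (1 < l)%N ->
  (rank_tail k a n l)%:~R <=
  49 * expR 12 * (F1 k a n)%:~R
    * (l%:R * expR (- (pi * a%:R / Num.sqrt (6 * n%:R))) ^+ l.-1) :> R.
Proof.
move=> k0 n36 kn an l1; rewrite F1E ifT; last lia.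
set M := (n.+1 - (a + k))%N.
have [s02 hn] := saddle_shift R n n36; set s := _ - _ in s02 hn.
have [t ht] := exists_pow2 R s s02.
have d0 : 0 <= (dpart M)%:~R :> R by rewrite ler0z dpart_ge0.
set z := expR (- (pi * a%:R / Num.sqrt (6 * n%:R))); have z0 : 0 < z by apply: expR_gt0.
set K := 49 * expR 12 * (dpart M)%:~R.
have K0 : 0 <= K by rewrite /K !mulr_ge0 ?expR_ge0.
have -> : K * (l%:R * z ^+ l.-1) = \sum_(i < l) (K * z ^+ l.-1).
  by rewrite sumr_const card_ord -mulr_natl; ring.
rewrite /rank_tail rmorph_sum /=; apply: ler_sum => i _.
case: leqP => hi; last by rewrite mulr_ge0 // exprn_ge0 // ltW.
have hlb := rank_exp_lb k a l k0 (ltnW l1).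
set j := (n - _)%N.
(* By [rank_exp_lb], the distance [M - j = rank_exp k a l + i - (k - 1) - a] is at least
   [l a - a]. *)
have la : ((l.-1) * a <= M - j)%N by rewrite /M /j; nia.
have la_n : ((l.-1) * a <= n)%N by nia.
have jM : (j <= M)%N by rewrite /M /j; nia.
have M1 : (1 < M <= n)%N by rewrite /M; lia.
apply: le_trans (dpart_ratio0 R s t n j M s02 ht hn jM M1) _.
suff h : expR 8 * expR (- (s * (M - j)%:R)) <= expR 12 * z ^+ l.-1.
  rewrite (_ : K * _ = 49 * (expR 12 * z ^+ l.-1) * (dpart M)%:~R); last first.
    by rewrite /K; ring.
  by rewrite ler_wpM2r // -mulrA ler_pM2l.
rewrite /z -expRM_natl -!expRD ler_expR.
have nr : 0 < n%:R :> R by rewrite ltr0n; lia.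
have h1 : s * (l.-1 * a)%:R <= s * (M - j)%:R.
  by rewrite ler_wpM2l ?ler_nat // ltW //; case/andP: s02.
(* Replacing [s] by [pi / sqrt (6 n)] over a distance of at most [n] costs [expR 4], whence
   [expR 12]. *)
have h2 : 4 / n%:R * (l.-1 * a)%:R <= 4 :> R.
  by rewrite mulrAC ler_pdivrMr // ler_pM2l // ler_nat.
have h3 : s * (l.-1 * a)%:R =
    l.-1%:R * (pi * a%:R / Num.sqrt (6 * n%:R)) - 4 / n%:R * (l.-1 * a)%:R.
  by rewrite /s mulrBl natrM; congr (_ - _); ring.
move: h1; rewrite h3 mulrN; lra.
Qed.

Theorem theorem1p3 (R : realType) (k : nat) (hk : (0 < k)%N) :
  (forall (m : int) (n : nat), (0 < n)%N ->
     (n%:R + 3) / 2 - 2 * k%:R < `|m|%:~R :> R ->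
     garvan_rank k m n = F1 k `|m|%N n)
  /\
  (forall c : R, 0 < c ->
     exists (C : R) (n0 : nat), 0 < C /\
       forall (m : int) (n : nat), (0 < n)%N -> (n0 <= n)%N ->
         c * Num.sqrt n%:R <= `|m|%:~R -> `|m|%:~R < n%:R / 2 :> R ->
         exists eps : R,
           `|eps| <= C * (expR (- (pi * `|m|%:~R / Num.sqrt (6 * n%:R)))
                          + expR (- (pi * Num.sqrt (n%:R / 6) / 5))) /\
           (garvan_rank k m n)%:~R = (F1 k `|m|%N n)%:~R * (1 + eps)).
Proof.
have absE (m : int) : `|m|%:~R = (`|m|%N)%:R :> R by rewrite -abszE.
split=> [m n n0|c c0].
  rewrite absE => hm; apply: garvan_rank_eqF1 => //.
  have : (n + 3)%:R < (4 * k + 2 * `|m|)%:R :> R.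
    by rewrite natrD (natrD _ (4 * k)) 2!natrM; lra.
  by rewrite ltr_nat.
(* Since [|m| >= c sqrt n], this bounds the first exponential uniformly and keeps [1 - z] away from
   0 in the sum over [l]. *)
set z0 : R := expR (- (pi * c / Num.sqrt 6)).
have s6 : 0 < Num.sqrt 6 :> R by rewrite sqrtr_gt0.
have z01 : z0 < 1.
  by rewrite expR_lt1 oppr_lt0 divr_gt0 // mulr_gt0 ?pi_gt0.
have K0 : 0 < 49 * expR 12 :> R by rewrite mulr_gt0 ?expR_gt0.
exists (49 * expR 12 * (2 / (1 - z0) ^+ 2)), (36 + (2 * k + 2))%N; split.
  by rewrite mulr_gt0 // divr_gt0 // exprn_gt0 // subr_gt0.
move=> m n n1 hn; rewrite absE; set a := `|m|%N => ca an.
have {}an : (2 * a < n)%N.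
  have : (2 * a)%:R < n%:R :> R by rewrite natrM; lra.
  by rewrite ltr_nat.
set z : R := expR (- (pi * a%:R / Num.sqrt (6 * n%:R))).
have zz0 : z <= z0.
  have sn : 0 < Num.sqrt n%:R :> R by rewrite sqrtr_gt0 ltr0n.
  rewrite ler_expR lerN2 sqrtrM //.
  have -> : pi * c / Num.sqrt 6 = pi / (Num.sqrt 6 * Num.sqrt n%:R) * (c * Num.sqrt n%:R).
    by move: (pi : R) => P; field; rewrite !lt0r_neq0.
  by rewrite [leRHS]mulrAC ler_pM2l // divr_gt0 ?pi_gt0 // mulr_gt0.
have F0 : 0 < (F1 k a n)%:~R :> R.
  by rewrite ltr0z F1E ifT ?dpart_gt0 //; lia.
set E : R := (\sum_(2 <= l < n.+2) (-1) ^+ l.-1 * rank_tail k a n l)%:~R.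
have hE : `|E| <= 49 * expR 12 * (F1 k a n)%:~R * (2 * z / (1 - z0) ^+ 2).
  have zp : 0 < z by apply: expR_gt0.
  rewrite /E rmorph_sum /=; apply: le_trans (ler_norm_sum _ _ _) _.
  apply: (@le_trans _ _ (\sum_(2 <= l < n.+2)
      49 * expR 12 * (F1 k a n)%:~R * (l%:R * z ^+ l.-1))).
    apply: ler_sum_nat => l /andP[l2 _].
    rewrite intrM normrM rmorphXn /= rmorphN1 normrX normrN1 expr1n mul1r.
    rewrite ger0_norm ?ler0z ?rank_tail_ge0 //.
    by apply: rank_tail_le => //; lia.
  rewrite -mulr_sumr ler_pM2l ?mulr_gt0 ?expR_gt0 //.
  have z1 : z < 1 by apply: le_lt_trans z01.
  apply: le_trans (sum_succ_geom_le R z n _) _; first by rewrite ltW.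
  rewrite ler_pM2l ?mulr_gt0 // lef_pV2 ?posrE ?exprn_gt0 ?subr_gt0 //.
  by rewrite ler_pXn2r ?nnegrE ?subr_ge0 ?lerD2l ?lerN2 // ltW.
(* The relative error is the signed sum of the terms [l >= 2] divided by the positive main term. *)
exists (E / (F1 k a n)%:~R); split.
  rewrite normrM normfV (gtr0_norm F0) ler_pdivrMr //.
  apply: le_trans hE _.
  rewrite [leLHS](_ : _ =
    49 * expR 12 * (2 / (1 - z0) ^+ 2) * z * (F1 k a n)%:~R); last first.
    by field; rewrite subr_eq0 eq_sym lt_eqF.
  rewrite ler_pM2r // ler_pM2l ?lerDl ?expR_ge0 //.
  by rewrite mulr_gt0 // divr_gt0 // exprn_gt0 // subr_gt0.
rewrite garvan_rank_split // rmorphD /= -/E mulrDr mulr1; congr (_ + _).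
by rewrite mulrC divfK // lt0r_neq0.
Qed.
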